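(* Let $q$ be a complex number with $|q|<1$, fix a square root $q^{1/2}$ and a fourth root $q^{1/4}$ with $(q^{1/4})^2=q^{1/2}$, and write $q^{k/2}=(q^{1/2})^k$, $q^{k/4}=(q^{1/4})^k$ for integers $k$. Define $$S_1(q)=q^{1/4}\frac{\mathfrak f(-q^3,-q^{11})}{\mathfrak f(-q^4,-q^{10})},\quad S_2(q)=q^{3/4}\frac{\mathfrak f(-q^2,-q^{12})}{\mathfrak f(-q^5,-q^{9})},\quad S_3(q)=q^{5/4}\frac{\mathfrak f(-q,-q^{13})}{\mathfrak f(-q^6,-q^{8})},$$ and let $S_i(q^2)$ denote the same expressions with $q$ replaced by $q^2$, the prefactors becoming $q^{1/2},q^{3/2},q^{5/2}$ respectively. Then \begin{enumerate} \item[(i)] $\dfrac{1}{S_1(q)}-S_1(q)=\dfrac{\phi(q^{7/2})\,\mathfrak f(-q^{1/2},-q^{13/2})}{q^{1/4}\psi(q^7)\,\mathfrak f(-q^3,-q^4)}$, \item[(ii)] $\dfrac{1}{S_1(q)}+S_1(q)=\dfrac{\phi(-q^{7/2})\,\mathfrak f(q^{1/2},q^{13/2})}{q^{1/4}\psi(q^7)\,\mathfrak f(-q^3,-q^4)}$, \item[(iii)] $\dfrac{1}{S_2(q)}-S_2(q)=\dfrac{\phi(q^{7/2})\,\mathfrak f(-q^{3/2},-q^{11/2})}{q^{3/4}\psi(q^7)\,\mathfrak f(-q^2,-q^5)}$, \item[(iv)] $\dfrac{1}{S_2(q)}+S_2(q)=\dfrac{\phi(-q^{7/2})\,\mathfrak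 f(q^{3/2},q^{11/2})}{q^{3/4}\psi(q^7)\,\mathfrak f(-q^2,-q^5)}$, \item[(v)] $\dfrac{1}{S_3(q)}-S_3(q)=\dfrac{\phi(q^{7/2})\,\mathfrak f(-q^{5/2},-q^{9/2})}{q^{5/4}\psi(q^7)\,\mathfrak f(-q,-q^6)}$, \item[(vi)] $\dfrac{1}{S_3(q)}+S_3(q)=\dfrac{\phi(-q^{7/2})\,\mathfrak f(q^{5/2},q^{9/2})}{q^{5/4}\psi(q^7)\,\mathfrak f(-q,-q^6)}$, \item[(vii)] $\displaystyle\prod_{i=1}^{3}\left(\frac{1}{S_i(q^2)}-S_i(q^2)\right)=\frac{\phi^3(q^7)\psi(q^7)}{q^{9/2}\psi^3(q^{14})\psi(q)}$, \item[(viii)] $\displaystyle\prod_{i=1}^{3}\left(\frac{1}{S_i(q^2)}+S_i(q^2)\right)=\frac{\phi^3(-q^7)\psi(-q^7)}{q^{9/2}\psi^3(q^{14})\psi(-q)}$. \end{enumerate}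
   Context: For complex $\lambda$ and $|q|<1$, $(\lambda;q)_\infty=\prod_{t\ge0}(1-\lambda q^t)$. Ramanujan's general theta function is $\mathfrak f(a,b)=\sum_{t=-\infty}^{\infty}a^{t(t+1)/2}b^{t(t-1)/2}$ for $|ab|<1$; by Jacobi's triple product $\mathfrak f(a,b)=(-a;ab)_\infty(-b;ab)_\infty(ab;ab)_\infty$. Further $\phi(q)=\mathfrak f(q,q)=\sum_{t\in\mathbb Z}q^{t^2}$ and $\psi(q)=\mathfrak f(q,q^3)=\sum_{t\ge0}q^{t(t+1)/2}=(q^2;q^2)_\infty/(q;q^2)_\infty$. Arguments such as $q^{7/2}$, $q^{1/2}$, $q^{13/2}$ are understood via the fixed root $q^{1/2}$. *)

(* Defs.v *)
From mathcomp Require Import all_boot all_order all_algebra.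
From mathcomp Require Import all_classical all_reals all_analysis.

Set Implicit Arguments.
Unset Strict Implicit.
Unset Printing Implicit Defensive.

Import Order.TTheory GRing.Theory Num.Theory.
Import numFieldNormedType.Exports.

Local Open Scope ring_scope.

(* Everything is stated over a numFieldType K, whose limits are taken for the
   topology of its norm; the intended instance is K = R[i] with R : realType,
   on which this topology is not found by canonical structures directly. *)

(* Sum over all of Z, as the sum of two one-sided series.  For the theta
   series below both converge absolutely when |ab| < 1. *)
Definition bilateral_sum (K : numFieldType) (u : int -> K) : K :=
  limn (series (fun n : nat => u (Posz n))) +
  limn (series (fun n : nat => u (Negz n))).

(* Both exponents are nonnegative integers and the divisions by 2 are exact;
   [a ^ m] with [m : int] satisfies [0 ^ 0 = 1]. *)
Definition ftheta (K : numFieldType) (a b : K) : K :=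
  bilateral_sum (fun t : int =>
    a ^ ((t * (t + 1)) %/ 2)%Z * b ^ ((t * (t - 1)) %/ 2)%Z).

Definition phi (K : numFieldType) (q : K) : K := ftheta q q.

Definition psi (K : numFieldType) (q : K) : K := ftheta q (q ^+ 3).

(* In [S1 x q], [S2 x q] and [S3 x q], the argument [x] is the chosen value
   of q^(1/4). *)
Definition S1 (K : numFieldType) (x q : K) : K :=
  x * (ftheta (- q ^+ 3) (- q ^+ 11) / ftheta (- q ^+ 4) (- q ^+ 10)).

Definition S2 (K : numFieldType) (x q : K) : K :=
  x ^+ 3 * (ftheta (- q ^+ 2) (- q ^+ 12) / ftheta (- q ^+ 5) (- q ^+ 9)).

Definition S3 (K : numFieldType) (x q : K) : K :=
  x ^+ 5 * (ftheta (- q) (- q ^+ 13) / ftheta (- q ^+ 6) (- q ^+ 8)).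

(* Main.v *)
(* Put A = f(-q^4,-q^10) and B = f(-q^3,-q^11), so that S1 = q^(1/4) B / A.  Both
   series identities AB = psi(q^7) f(-q^3,-q^4) and
   A^2 - q^(1/2) B^2 = phi(q^(7/2)) f(-q^(1/2),-q^(13/2)) come from re-indexing an
   absolutely convergent sum over Z^2 according to the parity of m + n, and
   (i) is their quotient; (ii) is the same with q^(1/2) changed to -q^(1/2), and
   S2, S3 are treated alike.  Multiplying the three relations at q^2 reduces
   (vii) and (viii) to a quotient of theta functions that Jacobi's triple product
   evaluates.  The triple product is obtained from the q-binomial theorem of length
   2n by letting n tend to infinity under the sum (Tannery); no infinite product
   involved vanishes.
   Since [x / 0 = 0], (i)-(vi) need no nonvanishing: if A or B is zero, so are both
   sides. *)

Require Import Defs.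
From mathcomp Require Import all_boot all_order all_algebra.
From mathcomp Require Import complex.
From mathcomp Require Import all_classical all_reals all_analysis.
From mathcomp Require Import ring zify.

Import Order.TTheory GRing.Theory Num.Theory.
Import numFieldNormedType.Exports.

Local Open Scope ring_scope.

(** * Absolutely summable families *)

Section UniqSums.
Variables (K : numDomainType) (T : eqType).
Implicit Types (s t : seq T).

Lemma big_uniq_subset (F : T -> K) s t : uniq s -> uniq t -> {subset s <= t} ->
  \sum_(i <- t) F i =
  \sum_(i <- s) F i + \sum_(i <- [seq i <- t | i \notin s]) F i.
Proof.
move=> us ut st; rewrite (bigID (mem s)) /= -[X in X + _]big_filter -[X in _ + X]big_filter; congr (_ + _).
apply: perm_big; apply: uniq_perm; rewrite ?filter_uniq// => i.
by rewrite mem_filter /=; case: (boolP (i \in s)) => // /st.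
Qed.

Lemma ler_sum_uniq_subset (F : T -> K) s t : (forall i, 0 <= F i) ->
  uniq s -> uniq t -> {subset s <= t} ->
  \sum_(i <- s) F i <= \sum_(i <- t) F i.
Proof.
by move=> F0 us ut st; rewrite (big_uniq_subset F s t)// lerDl sumr_ge0.
Qed.

End UniqSums.

(* Absolute summability: besides approximating [l], the finite family [s0] leaves
   only tails of small absolute sum. *)
Definition has_sum (K : numFieldType) (T : eqType) (u : T -> K) (l : K) : Prop :=
  forall e : K, 0 < e -> exists s0 : seq T,
    [/\ uniq s0, `|\sum_(i <- s0) u i - l| < e &
     forall s, uniq s -> {in s, forall i, i \notin s0} ->
       \sum_(i <- s) `|u i| < e].

Section HasSum.
Variable K : numFieldType.
Implicit Types T : eqType.

(** Enlarging [s0] adds only terms off [s0], whose total is small by the tail condition; hence the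
    halved tolerance. *)
Lemma has_sum_approx T (u : T -> K) (l e : K) : has_sum K T u l -> 0 < e ->
  exists s0 : seq T, [/\ uniq s0,
    forall s, uniq s -> {subset s0 <= s} -> `|\sum_(i <- s) u i - l| < e &
    forall s, uniq s -> {in s, forall i, i \notin s0} ->
       \sum_(i <- s) `|u i| < e].
Proof.
move=> ul e0; have e20 : 0 < e / 2 by rewrite divr_gt0.
have ltee : e / 2 < e by rewrite ltr_pdivrMr// ltr_pMr// ltr1n.
have [s0 [us0 s0l tail]] := ul _ e20; exists s0; split=> //; last first.
  by move=> s us ds; exact: lt_trans (tail _ us ds) ltee.
move=> s us s0s; rewrite (big_uniq_subset _ _ _ s0 s)//.
rewrite addrAC [ltRHS](splitr e) (le_lt_trans (ler_normD _ _))// ltrD//.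
apply: le_lt_trans (ler_norm_sum _ _ _) _; apply: tail; first exact: filter_uniq.
by move=> i; rewrite mem_filter => /andP[].
Qed.

Lemma has_sum_bounded T (u : T -> K) (l : K) : has_sum K T u l ->
  exists2 M : K, 0 < M & forall s, uniq s -> \sum_(i <- s) `|u i| < M.
Proof.
move=> /(_ 1 ltr01)[s0 [us0 _ tail]].
exists (\sum_(i <- s0) `|u i| + 1); first by rewrite ltr_wpDl// sumr_ge0.
move=> s us; rewrite (bigID (mem s0)) /= -[X in X + _]big_filter -[X in _ + X]big_filter ler_ltD//.
  apply: ler_sum_uniq_subset; rewrite ?filter_uniq// => i.
  by rewrite mem_filter => /andP[].
apply: tail; first exact: filter_uniq.
by move=> i; rewrite mem_filter => /andP[].
Qed.

Lemma has_sum_unique T (u : T -> K) (l l' : K) :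
  has_sum K T u l -> has_sum K T u l' -> l = l'.
Proof.
move=> ul ul'; apply/eqP; rewrite -subr_eq0 -normr_eq0; apply/negPn/negP => d0.
have e0 : 0 < `|l - l'| / 2 by rewrite divr_gt0// lt_neqAle eq_sym d0 normr_ge0.
have [s [us sl _]] := has_sum_approx _ _ _ _ ul e0.
have [s' [us' sl' _]] := has_sum_approx _ _ _ _ ul' e0.
have ut := undup_uniq (s ++ s').
have h : {subset s <= undup (s ++ s')} by move=> i; rewrite mem_undup mem_cat => ->.
have h' : {subset s' <= undup (s ++ s')}
  by move=> i; rewrite mem_undup mem_cat orbC => ->.
have := ltrD (sl _ ut h) (sl' _ ut h'); rewrite -splitr [X in X + _ < _]distrC.
set t := \sum_(i <- _) _ => tt.
have := le_lt_trans (ler_normD _ _) tt.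
by rewrite addrA subrK ltxx.
Qed.

Lemma eq_has_sum T (u v : T -> K) (l : K) :
  u =1 v -> has_sum K T u l -> has_sum K T v l.
Proof.
move=> uv ul e /ul[s0 [us0 s0l tail]]; exists s0; split=> //.
  by rewrite -(eq_bigr _ (fun i _ => uv i)).
by move=> s us ds; rewrite -(eq_bigr _ (fun i _ => congr1 _ (uv i))) tail.
Qed.

Lemma has_sum_reindex T T' (h : T' -> T) (u : T -> K) (l : K) : bijective h ->
  has_sum K T' (u \o h) l -> has_sum K T u l.
Proof.
move=> [g gK hK] ul e /ul[s0 [us0 s0l tail]]; exists (map h s0); split=> //.
- by rewrite map_inj_uniq//; apply: can_inj gK.
- by rewrite big_map.
- move=> s us ds; have -> : s = map h (map g s) by rewrite mapK.
  rewrite big_map; apply: tail; first by rewrite map_inj_uniq//; apply: can_inj hK.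
  move=> i /mapP[j js ->]; apply/negP => gjs0.
  by have /mapP[] := ds _ js; exists (g j).
Qed.

Lemma has_sum_sum T T' (u : T + T' -> K) (l l' : K) :
  has_sum K T (u \o inl) l -> has_sum K T' (u \o inr) l' ->
  has_sum K (T + T')%type u (l + l').
Proof.
move=> ul ul' e e0; have e20 : 0 < e / 2 by rewrite divr_gt0.
have [s [us sl stail]] := ul _ e20; have [s' [us' sl' stail']] := ul' _ e20.
have inl_inj : injective (@inl T T') by move=> ? ? [].
have inr_inj : injective (@inr T T') by move=> ? ? [].
exists (map inl s ++ map inr s'); split.
- rewrite cat_uniq !map_inj_uniq// us us' andbT /=; apply/hasPn => x /mapP[y _ ->].
  by apply/mapP => -[].
- rewrite big_cat/= !big_map opprD addrACA [ltRHS](splitr e).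
  by rewrite (le_lt_trans (ler_normD _ _))// ltrD.
- move=> t ut dt; rewrite [ltRHS](splitr e).
  pose f (x : T + T') := if x is inl y then Some y else None.
  pose f' (x : T + T') := if x is inr y then Some y else None.
  have -> : \sum_(i <- t) `|u i| = \sum_(i <- pmap f t) `|(u \o inl) i| +
     \sum_(i <- pmap f' t) `|(u \o inr) i|.
    elim: t {ut dt} => [|[x|x] t IH]; rewrite /= ?big_nil ?addr0 ?big_cons//.
    + by rewrite IH addrA.
    + by rewrite IH addrCA.
  apply: ltrD.
  + apply: stail.
      by apply: (@pmap_uniq _ _ f inl) => // -[].
    move=> i; rewrite mem_pmap => /mapP[[x|x] xt//= [->]]; apply/negP => xs.
    by have := dt _ xt; rewrite mem_cat map_f.
  + apply: stail'.
      by apply: (@pmap_uniq _ _ f' inr) => // -[].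
    move=> i; rewrite mem_pmap => /mapP[[x|x] xt//= [->]]; apply/negP => xs.
    by have := dt _ xt; rewrite mem_cat map_f// orbT.
Qed.

Lemma has_sum_scale T (u : T -> K) (l c : K) :
  has_sum K T u l -> has_sum K T (fun i => c * u i) (c * l).
Proof.
move=> ul e e0; have d0 : 0 < `|c| + 1 by rewrite ltr_wpDl.
have [s [us sl tail]] := ul _ (divr_gt0 e0 d0).
have h x : 0 <= x -> x < e / (`|c| + 1) -> `|c| * x < e.
  move=> x0; rewrite ltr_pdivlMr// => xe; apply: le_lt_trans xe.
  by rewrite mulrDr mulr1 mulrC lerDl.
exists s; split=> //.
  by rewrite -mulr_sumr -mulrBr normrM h.
move=> t ut dt; under eq_bigr do rewrite normrM.
by rewrite -mulr_sumr h ?sumr_ge0// tail.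
Qed.

(** A pair outside the rectangle [s] by [t] has its first coordinate off [s] or its second off [t],
    so a tail of the product is bounded by a tail of one factor times a global bound of the
    other. *)
Lemma has_sum_prod T T' (u : T -> K) (v : T' -> K) (l l' : K) :
  has_sum K T u l -> has_sum K T' v l' ->
  has_sum K (T * T')%type (fun i => u i.1 * v i.2) (l * l').
Proof.
move=> ul vl e e0.
have [M M0 uM] := has_sum_bounded _ _ _ ul.
have [N N0 vN] := has_sum_bounded _ _ _ vl.
(* [L] dominates [M], [N] and the norm of [l'], so one tolerance [e / (2 * L)] serves every error
   term. *)
pose L := `|l'| + M + N.
have L0 : 0 < L by rewrite /L -addrA ltr_wpDl// addr_gt0.
have d0 : 0 < e / (2 * L) by rewrite divr_gt0// mulr_gt0.
have [s [us sl stail]] := ul _ d0; have [t [ut tl ttail]] := vl _ d0.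
have eE : e = e / (2 * L) * L + L * (e / (2 * L)).
  by field; rewrite lt0r_neq0.
have l'L : `|l'| <= L by rewrite /L -addrA lerDl addr_ge0// ltW.
have ML : M <= L by rewrite /L addrAC lerDr addr_ge0// ltW.
have NL : N <= L by rewrite /L lerDr addr_ge0// ltW.
exists [seq (i, j) | i <- s, j <- t]; split.
- by rewrite allpairs_uniq// => -[? ?] [? ?].
- rewrite big_allpairs -/(map _ _) /=.
  under eq_bigr do rewrite -mulr_sumr; rewrite -mulr_suml.
  have -> : (\sum_(i <- s) u i) * (\sum_(i <- t) v i) - l * l' =
    (\sum_(i <- s) u i) * (\sum_(i <- t) v i - l') + (\sum_(i <- s) u i - l) * l'.
    by ring.
  rewrite [ltRHS]eE addrC (le_lt_trans (ler_normD _ _))// !normrM ltr_leD//.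
    have [->|l'0] := eqVneq l' 0; first by rewrite normr0 mulr0 mulr_gt0.
    have l'p : 0 < `|l'| by rewrite normr_gt0.
    by apply: lt_le_trans (_ : e / (2 * L) * `|l'| <= _); rewrite ?ltr_pM2r ?ler_pM2l.
  apply: ler_pM => //; last exact: ltW.
  by apply: le_trans (ler_norm_sum _ _ _) (le_trans (ltW (uM _ us)) ML).
- move=> r ur dr.
  (* [s1] and [t1] enclose the projections of [r]; the pairs of [r] with first coordinate off [s]
     lie in [big1], the remaining ones in [big2]. *)
  pose s1 := undup (map fst r ++ s); pose t1 := undup (map snd r ++ t).
  pose s2 := [seq i <- s1 | i \notin s]; pose t2 := [seq i <- t1 | i \notin t].
  have us1 : uniq s1 by exact: undup_uniq.
  have ut1 : uniq t1 by exact: undup_uniq.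
  pose big1 := [seq (i, j) | i <- s2, j <- t1].
  pose big2 := [seq (i, j) | i <- s1, j <- t2].
  rewrite (bigID (fun i => i.1 \notin s)) /=.
  rewrite -[X in X + _]big_filter -[X in _ + X]big_filter [ltRHS]eE.
  have hr i : i \in r -> (i.1 \in s1) && (i.2 \in t1).
    by move=> ir; rewrite !mem_undup !mem_cat !map_f.
  apply: le_lt_trans (_ : \sum_(i <- big1) `|u i.1 * v i.2| +
      \sum_(i <- big2) `|u i.1 * v i.2| < _).
    apply: lerD.
      apply: ler_sum_uniq_subset; rewrite ?filter_uniq ?allpairs_uniq ?filter_uniq//.
        by move=> [? ?] [? ?].
      move=> [i j]; rewrite mem_filter => /andP[/= is0 /hr/andP[/= i1 j1]].
      by apply/allpairsP; exists (i, j); rewrite /= mem_filter is0 i1 j1.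
    apply: ler_sum_uniq_subset; rewrite ?filter_uniq ?allpairs_uniq ?filter_uniq//.
      by move=> [? ?] [? ?].
    move=> [i j]; rewrite mem_filter negbK => /andP[/= is0 ijr].
    have /andP[/= i1 j1] := hr _ ijr.
    apply/allpairsP; exists (i, j); rewrite /= mem_filter i1 j1 andbT; split=> //.
    apply/negP => jt; have /negP := dr _ ijr; apply.
    by apply/allpairsP; exists (i, j).
  have ds2 : {in s2, forall i, i \notin s} by move=> i; rewrite mem_filter => /andP[].
  have dt2 : {in t2, forall i, i \notin t} by move=> i; rewrite mem_filter => /andP[].
  have us2 : uniq s2 by exact: filter_uniq.
  have ut2 : uniq t2 by exact: filter_uniq.
  rewrite !big_allpairs /=.
  under eq_bigr do (under eq_bigr do rewrite normrM; rewrite -mulr_sumr).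
  under [X in _ + X < _]eq_bigr do (under eq_bigr do rewrite normrM; rewrite -mulr_sumr).
  rewrite -!mulr_suml ltrD//.
    by apply: ltr_pM; rewrite ?sumr_ge0 ?stail// (lt_le_trans (vN _ ut1)).
  by apply: ltr_pM; rewrite ?sumr_ge0 ?ttail// (lt_le_trans (uM _ us1)).
Qed.

End HasSum.

(** * Theta series as absolutely summable families *)

(* A property of [R[i]] that also makes the norm archimedean, so that the theory
   below can be developed over an abstract [numFieldType]. *)
Definition abs_complete (K : numFieldType) : Prop :=
  forall u : nat -> K, (exists M : K, forall n, \sum_(0 <= k < n) `|u k| <= M) ->
    cvgn (series u).

Section AbsComplete.
Variable K : numFieldType.
Hypothesis compl : abs_complete K.

(** A partial sum gives the approximation. The series of absolute values converges too, and a finite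
    set of indices beyond [n] lies in some interval from [n] to [m], so its sum is small. *)
Lemma has_sum_series (u : nat -> K) (M : K) :
  (forall n, \sum_(0 <= k < n) `|u k| <= M) ->
  has_sum K nat u (limn (series u)).
Proof.
move=> uM e e0; have e20 : 0 < e / 2 by rewrite divr_gt0.
have cu : cvgn (series u) by apply: compl; exists M.
have cv : cvgn (series (fun k => `|u k|)).
  by apply: compl; exists M => n; under eq_bigr do rewrite normr_id; exact: uM.
move/cvgrPdist_lt : cu => /(_ _ e0)[n1 _ h1].
move/cvgrPdist_lt : cv => /(_ _ e20)[n2 _ h2].
pose n := maxn n1 n2; exists (index_iota 0 n); split.
- exact: iota_uniq.
- by rewrite distrC; apply: h1; rewrite /= leq_maxl.
- move=> s us ds; pose m := maxn n (\max_(i <- s) i.+1).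
  have nm : (n <= m)%N by exact: leq_maxl.
  apply: le_lt_trans (_ : \sum_(n <= k < m) `|u k| < _).
    apply: ler_sum_uniq_subset => //; first exact: iota_uniq.
    move=> i si; rewrite mem_index_iota; apply/andP; split.
      by have := ds _ si; rewrite mem_index_iota leq0n /= -leqNgt.
    rewrite /m leq_max; apply/orP; right.
    by apply: (@leq_bigmax_seq _ s predT (fun i => i.+1)).
  have n2n : (n2 <= n)%N by exact: leq_maxr.
  have h2m := h2 m (leq_trans n2n nm); have h2n := h2 n n2n.
  have := ltrD h2n h2m; rewrite -splitr [X in X + _ < _]distrC => h.
  apply: le_lt_trans h; apply: le_trans (ler_normD _ _).
  rewrite addrA subrK distrC /series /= [in leRHS](@big_cat_nat _ _ _ n)//=.
  by rewrite addrAC subrr add0r ger0_norm// sumr_ge0.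
Qed.

Lemma geometric_sum_le (r : K) n : 0 <= r -> r < 1 ->
  \sum_(0 <= k < n) r ^+ k <= (1 - r)^-1.
Proof.
move=> r0 r1; have h : 0 < 1 - r by rewrite subr_gt0.
rewrite -(ler_pM2l h) mulfV ?gt_eqF// big_mkord -opprB mulNr -subrX1 opprB.
by rewrite lerBlDr lerDl exprn_ge0.
Qed.

(** Terms of a convergent series tend to 0; completeness stands in here for the archimedean property
    of the norm. *)
Lemma cvg_geometric0 (r : K) : `|r| < 1 -> ((fun n => r ^+ n) @ \oo --> 0)%classic.
Proof.
move=> r1; apply: cvg_series_cvg_0; apply: compl; exists (1 - `|r|)^-1 => n.
by under eq_bigr do rewrite normrX; exact: geometric_sum_le.
Qed.

End AbsComplete.

Lemma bilateral_bij : bijective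
  (fun x : nat + nat => match x with inl n => Posz n | inr n => Negz n end).
Proof.
by exists (fun z => match z with Posz n => inl n | Negz n => inr n end); case.
Qed.

Definition theta_term (K : numFieldType) (a b : K) (t : int) : K :=
  a ^ ((t * (t + 1)) %/ 2)%Z * b ^ ((t * (t - 1)) %/ 2)%Z.

Lemma bin2_double n : ('C(n.+1, 2) * 2 = n * n.+1)%N.
Proof. by elim: n => // n IH; rewrite binS bin1 mulnDl IH; lia. Qed.

Lemma divz2_eq (x y : int) : x = y * 2 -> (x %/ 2)%Z = y.
Proof. by move=> ->; rewrite mulzK. Qed.

Lemma triz_double (t : int) : ((t * (t + 1)) %/ 2)%Z * 2 = t * (t + 1).
Proof.
case: t => n.
  rewrite (divz2_eq _ 'C(n.+1, 2)%:Z); have := bin2_double n; lia.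
rewrite (divz2_eq _ 'C(n.+1, 2)%:Z); have := bin2_double n; rewrite NegzE; lia.
Qed.

Lemma triz_pred_double (t : int) : ((t * (t - 1)) %/ 2)%Z * 2 = t * (t - 1).
Proof.
by have := triz_double (t - 1); rewrite (_ : (t - 1) * (t - 1 + 1) = t * (t - 1)) //; ring.
Qed.

Section ThetaTerm.
Variable K : numFieldType.
Implicit Types a b : K.

Lemma theta_term_Posz a b n :
  theta_term K a b (Posz n) = a ^+ 'C(n.+1, 2) * b ^+ 'C(n, 2).
Proof.
rewrite /theta_term (divz2_eq (n%:Z * (n%:Z + 1)) 'C(n.+1, 2)%:Z); last first.
  by have := bin2_double n; lia.
rewrite (divz2_eq (n%:Z * (n%:Z - 1)) 'C(n, 2)%:Z)//.
by case: n => // n; have := bin2_double n; lia.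
Qed.

Lemma theta_term_Negz a b n :
  theta_term K a b (Negz n) = a ^+ 'C(n.+1, 2) * b ^+ 'C(n.+2, 2).
Proof.
rewrite /theta_term (divz2_eq (Negz n * (Negz n + 1)) 'C(n.+1, 2)%:Z); last first.
  by have := bin2_double n; rewrite NegzE; lia.
rewrite (divz2_eq (Negz n * (Negz n - 1)) 'C(n.+2, 2)%:Z)//.
by have := bin2_double n.+1; rewrite NegzE; lia.
Qed.

(** The terms are [(a * b) ^+ 'C(n, 2) * a ^+ n] and [(a * b) ^+ 'C(n.+1, 2) * b ^+ n.+1], and both
    binomials are at least [n.-1]. *)
Lemma theta_term_bound a b : `|a| <= 1 -> `|b| <= 1 -> `|a * b| < 1 ->
  forall n, `|theta_term K a b (Posz n)| <= `|a * b| ^+ n.-1 /\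
            `|theta_term K a b (Negz n)| <= `|a * b| ^+ n.-1.
Proof.
move=> a1 b1 ab1 n; rewrite theta_term_Posz theta_term_Negz !normrM !normrX.
have hC m : (m.-1 <= 'C(m, 2))%N.
  by case: m => // m; rewrite -(leq_pmul2r (isT : 0 < 2)%N) bin2_double; nia.
have h k : (n.-1 <= k)%N -> (`|a| * `|b|) ^+ k <= (`|a| * `|b|) ^+ n.-1.
  by move=> nk; apply: ler_wiXn2l => //; rewrite ?mulr_ge0// -normrM ltW.
split.
  rewrite binS bin1 exprD mulrAC -exprMn -[leRHS]mulr1.
  by rewrite ler_pM ?exprn_ge0 ?mulr_ge0 ?h ?exprn_ile1.
rewrite (binS n.+1) bin1 exprD mulrA -exprMn -[leRHS]mulr1.
rewrite ler_pM ?exprn_ge0 ?mulr_ge0 ?exprn_ile1// h//.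
by apply: leq_trans (hC n) _; rewrite binS leq_addr.
Qed.

Hypothesis compl : abs_complete K.

Lemma ftheta_has_sum a b : `|a| <= 1 -> `|b| <= 1 -> `|a * b| < 1 ->
  has_sum K int (theta_term K a b) (ftheta a b).
Proof.
move=> a1 b1 ab1; have hb := theta_term_bound a b a1 b1 ab1.
(* The exponent [n.-1] is 0 at both [n = 0] and [n = 1], whence the extra 1 beside the geometric
   bound. *)
have M (u : nat -> K) : (forall n, `|u n| <= `|a * b| ^+ n.-1) ->
    forall n, \sum_(0 <= k < n) `|u k| <= 1 + (1 - `|a * b|)^-1.
  move=> ub n; apply: le_trans (ler_sum _ (fun i _ => ub i)) _.
  case: n => [|n]; first by rewrite big_nil addr_ge0// invr_ge0 subr_ge0 ltW.
  by rewrite big_nat_recl// expr0 lerD2l geometric_sum_le.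
apply: (has_sum_reindex _ _ _ _ _ _ bilateral_bij); rewrite /ftheta /bilateral_sum.
apply: has_sum_sum.
  exact: (has_sum_series _ compl (fun n => theta_term K a b (Posz n)) _
    (M _ (fun n => proj1 (hb n)))).
exact: (has_sum_series _ compl (fun n => theta_term K a b (Negz n)) _
  (M _ (fun n => proj2 (hb n)))).
Qed.

(** The substitution of [- t] for [t] exchanges the two triangular exponents. *)
Lemma fthetaC a b : `|a| <= 1 -> `|b| <= 1 -> `|a * b| < 1 ->
  ftheta a b = ftheta b a.
Proof.
move=> a1 b1 ab1; apply: (has_sum_unique _ _ _ _ _ (ftheta_has_sum _ _ a1 b1 ab1)).
have oppbij : bijective (@GRing.opp int) by exists (@GRing.opp int); exact: opprK.
apply: (has_sum_reindex _ _ _ _ _ _ oppbij).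
have := ftheta_has_sum b a b1 a1; rewrite mulrC => /(_ ab1).
apply: eq_has_sum => t; rewrite /theta_term /= mulrC.
by congr (_ ^ (divz _ 2) * _ ^ (divz _ 2)); ring.
Qed.

End ThetaTerm.

(** * Absolute convergence over the real and complex numbers *)

Lemma real_abs_complete (R : realType) : abs_complete R.
Proof.
move=> u [M uM]; apply: normed_cvg; apply: nondecreasing_is_cvgn.
  move=> n m nm; rewrite /series /= [leRHS](@big_cat_nat _ _ _ n)//= lerDl.
  by rewrite sumr_ge0.
by exists M => _ [n _ <-]; exact: uM.
Qed.

Lemma complex_norm_real (R : rcfType) (x : R) : `|x%:C%C| = `|x|%:C%C.
Proof. by rewrite normc_def /= expr0n addr0 sqrtr_sqr. Qed.

Lemma complex_norm_bounds (R : rcfType) (z : R[i]) :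
  [/\ `|complex.Re z|%:C%C <= `|z|, `|complex.Im z|%:C%C <= `|z| &
      `|z| <= (`|complex.Re z| + `|complex.Im z|)%:C%C].
Proof.
split.
- by rewrite normc_def lecR -sqrtr_sqr ler_wsqrtr// lerDl sqr_ge0.
- by rewrite normc_def lecR -sqrtr_sqr ler_wsqrtr// lerDr sqr_ge0.
- rewrite rmorphD /= -!complex_norm_real {1}(complexE z).
  rewrite (le_trans (ler_normD _ _))// normrM.
  have -> : `|'i%C| = 1 :> R[i].
    by rewrite normc_def /= expr0n add0r expr1n sqrtr1.
  by rewrite mul1r.
Qed.

(** Real and imaginary parts are dominated by the norm, so both real series converge; their limits
    are the parts of the complex limit. *)
Lemma complex_abs_complete (R : realType) : abs_complete R[i].
Proof.
move=> u [M uM].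
have M0 : 0 <= M by have := uM 0%N; rewrite big_nil.
(* A nonnegative element of [R[i]] is real, so the bound descends to [R]. *)
have ME : M = (complex.Re M)%:C%C by rewrite RRe_real// ger0_real.
have cvgp (p : R[i] -> R) : (forall z, `|p z|%:C%C <= `|z|) ->
    cvgn (series (p \o u)).
  move=> ple; apply: real_abs_complete; exists (complex.Re M) => n.
  rewrite -lecR -ME; apply: le_trans (uM n); rewrite rmorph_sum /=.
  by apply: ler_sum => i _; exact: ple.
have seriesp (p : {additive R[i] -> R}) n : p (series u n) = series (p \o u) n.
  by rewrite /series /= raddf_sum.
have /cvgrPdist_lt cx : cvgn (series (@complex.Re R \o u)).
  by apply: cvgp => z; case: (complex_norm_bounds _ z).
have /cvgrPdist_lt cy : cvgn (series (@complex.Im R \o u)).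
  by apply: cvgp => z; case: (complex_norm_bounds _ z).
apply/cvg_ex; exists (Complex (limn (series (@complex.Re R \o u)))
   (limn (series (@complex.Im R \o u)))).
apply/cvgrPdist_lt => e e0.
have eE : e = (complex.Re e)%:C%C by rewrite RRe_real// gtr0_real.
have e1 : 0 < complex.Re e by rewrite -ltcR -eE.
have e20 : 0 < complex.Re e / 2 by rewrite divr_gt0.
have [n1 _ h1] := cx _ e20; have [n2 _ h2] := cy _ e20.
exists (maxn n1 n2) => // n; rewrite /= geq_max => /andP[nn1 nn2].
have [_ _] := complex_norm_bounds _ (Complex (limn (series (@complex.Re R \o u)))
   (limn (series (@complex.Im R \o u))) - series u n).
move/le_lt_trans; apply.
rewrite eE ltcR [ltRHS]splitr ltrD//.
  have := h1 n nn1; rewrite -(seriesp (@complex.Re R)).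
  by case: (series u n).
have := h2 n nn2; rewrite -(seriesp (@complex.Im R)).
by case: (series u n).
Qed.

(** * Products of theta functions *)

(** Rotated coordinates on pairs of even sum ([inl]) and of odd sum ([inr]); in them the exponents
    of the double series below separate into an [r] part and an [s] part. *)
Definition parity_split (x : (int * int) + (int * int)) : int * int :=
  match x with
  | inl (r, s) => (r - s, r + s)
  | inr (r, s) => (r - s, r + s + 1)
  end.

Lemma parity_split_bij : bijective parity_split.
Proof.
exists (fun x : int * int => let: (m, n) := x in
  let p := (((m + n) %/ 2)%Z, ((n - m) %/ 2)%Z) in
  if ((m + n) %% 2)%Z == 0 then inl p else inr p).
- case=> -[r s] /=; case: ifP => h.
  + by congr (inl (_, _)); lia.
  + by exfalso; move: h; lia.
  + by exfalso; move: h; lia.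
  + by congr (inr (_, _)); lia.
- by case=> m n /=; case: ifP => h /=; congr (_, _); lia.
Qed.

(** Put [N = r + s]. The index [t = k] for [N = 2 * k], and [t = - k] for [N = 2 * k + 1], make the
    exponent [2 * t ^ 2 - t] of [psi] equal to [N * (N - 1) / 2]. The parity of [r - s] recovers
    that of [N]. *)
Definition parity_fold (x : int * int) : int * int :=
  let: (r, s) := x in let k := ((r + s) %/ 2)%Z in
  (if ((r + s) %% 2)%Z == 0 then k else - k, r - s).

Lemma parity_fold_bij : bijective parity_fold.
Proof.
exists (fun x : int * int => let: (m, n) := x in
  let N := if (n %% 2)%Z == 0 then 2 * m else 1 - 2 * m in
  (((N + n) %/ 2)%Z, ((N - n) %/ 2)%Z)).
- by case=> r s /=; case: ifP => h; case: ifP => h'; congr (_, _); lia.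
- by case=> m n /=; case: ifP => h; case: ifP => h'; congr (_, _); lia.
Qed.

Ltac tri_atoms :=
  repeat match goal with
  | |- context [((?t * (?t + 1)) %/ 2)%Z] =>
      have := triz_double t; move: ((t * (t + 1)) %/ 2)%Z => ? ?
  | |- context [((?t * (?t - 1)) %/ 2)%Z] =>
      have := triz_pred_double t; move: ((t * (t - 1)) %/ 2)%Z => ? ?
  end.

(* Integer exponents are compared after clearing the denominators [2] of the
   triangular numbers, which are otherwise opaque. *)
Ltac tri_solve := tri_atoms; lia.

Section ThetaProducts.
Variable K : numFieldType.
Hypothesis compl : abs_complete K.
Implicit Types c d e : K.

(** With all arguments monomials in the same nonzero [c] and [d], two products of terms agree as
    soon as two integer exponents do. *)
Lemma theta_term_monomial c d (i j k l : nat) (t : int) : c != 0 -> d != 0 ->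
  theta_term K (c ^+ i * d ^+ j) (c ^+ k * d ^+ l) t =
  c ^ (i%:Z * ((t * (t + 1)) %/ 2)%Z + k%:Z * ((t * (t - 1)) %/ 2)%Z) *
  d ^ (j%:Z * ((t * (t + 1)) %/ 2)%Z + l%:Z * ((t * (t - 1)) %/ 2)%Z).
Proof.
move=> c0 d0; rewrite /theta_term !expfzMl !exprnP !exprz_exp !expfzDr//.
by rewrite -!mulrA; congr (_ * _); rewrite mulrCA.
Qed.

Lemma monomialM c d (i j k l : int) : c != 0 -> d != 0 ->
  c ^ i * d ^ j * (c ^ k * d ^ l) = c ^ (i + k) * d ^ (j + l).
Proof. by move=> c0 d0; rewrite mulrACA -!expfzDr. Qed.

Lemma norm_monomial_lt1 c d (i j : nat) : `|c| < 1 -> `|d| < 1 ->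
  (0 < i + j)%N -> `|c ^+ i * d ^+ j| < 1.
Proof.
move=> c1 d1; rewrite normrM !normrX; case: i j => [|i] [|j]// _.
- by rewrite mul1r exprn_ilt1.
- by rewrite mulr1 exprn_ilt1.
- by rewrite mulr_ilt1 ?exprn_ge0 ?exprn_ilt1.
Qed.

Lemma ftheta_monomial_has_sum c d (i j k l : nat) : `|c| < 1 -> `|d| < 1 ->
  (0 < i + j)%N -> (0 < k + l)%N ->
  has_sum K int (theta_term K (c ^+ i * d ^+ j) (c ^+ k * d ^+ l))
    (ftheta (c ^+ i * d ^+ j) (c ^+ k * d ^+ l)).
Proof.
move=> c1 d1 ij kl.
have h1 := norm_monomial_lt1 _ _ _ _ c1 d1 ij.
have h2 := norm_monomial_lt1 _ _ _ _ c1 d1 kl.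
by apply: ftheta_has_sum => //; rewrite ?ltW// normrM mulr_ilt1.
Qed.

(* The case [ab = cd] of the expansion of a product of two theta functions, with
   [a = b], parametrised so that no quotient of the arguments occurs. *)
Lemma phi_mul_ftheta c e : c != 0 -> e != 0 -> `|c| < 1 -> `|e| < 1 ->
  ftheta (c * e) (c * e) * ftheta c (c * e ^+ 2) =
  ftheta (c ^+ 2 * e) (c ^+ 2 * e ^+ 3) ^+ 2 +
  c * ftheta (c ^+ 4 * e ^+ 3) e ^+ 2.
Proof.
move=> c0 e0 c1 e1.
pose HS := ftheta_monomial_has_sum c e.
have h1 := HS 1 1 1 1 c1 e1 isT isT.
have h2 := HS 1 0 1 2 c1 e1 isT isT.
have h3 := HS 2 1 2 3 c1 e1 isT isT.
have h4 := HS 4 3 0 1 c1 e1 isT isT.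
have hL := has_sum_prod _ _ _ _ _ _ _ h1 h2.
have hA := has_sum_prod _ _ _ _ _ _ _ h3 h3.
have hB := has_sum_scale _ _ _ _ c (has_sum_prod _ _ _ _ _ _ _ h4 h4).
suff : ftheta (c ^+ 1 * e ^+ 1) (c ^+ 1 * e ^+ 1) *
    ftheta (c ^+ 1 * e ^+ 0) (c ^+ 1 * e ^+ 2) =
  ftheta (c ^+ 2 * e ^+ 1) (c ^+ 2 * e ^+ 3) *
    ftheta (c ^+ 2 * e ^+ 1) (c ^+ 2 * e ^+ 3) +
  c * (ftheta (c ^+ 4 * e ^+ 3) (c ^+ 0 * e ^+ 1) *
    ftheta (c ^+ 4 * e ^+ 3) (c ^+ 0 * e ^+ 1)).
  by rewrite !expr1 !expr0 !mulr1 !mul1r.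
apply: (has_sum_unique _ _ _ _ _ hL).
(* Index pairs of even sum yield the first square, those of odd sum yield [c] times the second. *)
apply: (has_sum_reindex _ _ _ _ _ _ parity_split_bij); apply: has_sum_sum.
- apply: eq_has_sum hA => -[r s] /=; rewrite !theta_term_monomial// !monomialM//.
  congr (c ^ _ * e ^ _); tri_solve.
- apply: eq_has_sum hB => -[r s] /=; rewrite !theta_term_monomial// !monomialM//.
  rewrite mulrA -{1}[c]expr1z -expfzDr//.
  congr (c ^ _ * e ^ _); tri_solve.
Qed.

(** The bijection [parity_fold] matches the terms of the two double series one by one. *)
Lemma psi_mul_ftheta c d : c != 0 -> d != 0 -> `|c| < 1 -> `|d| < 1 ->
  psi (c * d) * ftheta c d = ftheta c (c * d ^+ 2) * ftheta d (c ^+ 2 * d).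
Proof.
move=> c0 d0 c1 d1.
pose HS := ftheta_monomial_has_sum c d.
have hL := has_sum_prod _ _ _ _ _ _ _ (HS 1 1 3 3 c1 d1 isT isT)
  (HS 1 0 0 1 c1 d1 isT isT).
have hR := has_sum_prod _ _ _ _ _ _ _ (HS 1 0 1 2 c1 d1 isT isT)
  (HS 0 1 2 1 c1 d1 isT isT).
suff : ftheta (c ^+ 1 * d ^+ 1) (c ^+ 3 * d ^+ 3) *
    ftheta (c ^+ 1 * d ^+ 0) (c ^+ 0 * d ^+ 1) =
  ftheta (c ^+ 1 * d ^+ 0) (c ^+ 1 * d ^+ 2) *
    ftheta (c ^+ 0 * d ^+ 1) (c ^+ 2 * d ^+ 1).
  by rewrite /psi exprMn !expr1 !expr0 !mulr1 !mul1r.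
apply: (has_sum_unique _ _ _ _ _ hL).
apply: (has_sum_reindex _ _ _ _ _ _ parity_fold_bij).
apply: eq_has_sum hR => -[r s] /=; rewrite !theta_term_monomial// !monomialM//.
case: ifP => h.
- have [k ks] : exists k, s = 2 * k - r by exists ((r + s) %/ 2)%Z; lia.
  have -> : ((r + s) %/ 2)%Z = k by lia.
  rewrite {}ks {h}; congr (c ^ _ * d ^ _); tri_solve.
- have [k ks] : exists k, s = 2 * k + 1 - r by exists ((r + s) %/ 2)%Z; lia.
  have -> : ((r + s) %/ 2)%Z = k by lia.
  rewrite {}ks {h}; congr (c ^ _ * d ^ _); tri_solve.
Qed.

End ThetaProducts.

(** * Infinite products *)

Definition qpoch (K : numFieldType) (a p : K) (n : nat) : K :=
  \prod_(0 <= k < n) (1 - a * p ^+ k).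

Definition qpochoo (K : numFieldType) (a p : K) : K := limn (qpoch K a p).

Section QPoch.
Variable K : numFieldType.
Hypothesis compl : abs_complete K.
Implicit Types a b p z : K.

Lemma eq_cvgn (u v : nat -> K) (l : K) : u =1 v ->
  (u @ \oo --> l)%classic -> (v @ \oo --> l)%classic.
Proof. by move=> /funext ->. Qed.

(** Each new factor lowers the product [P] by [P] times the new [y], hence by at most that [y], as
    [P <= 1]. *)
Lemma weierstrass_product (y : nat -> K) m n : (forall k, 0 <= y k <= 1) ->
  1 - \sum_(m <= k < n) y k <= \prod_(m <= k < n) (1 - y k).
Proof.
move=> y01; have [nm|mn] := leqP n m; first by rewrite !big_geq// subr0.
rewrite -(subnKC (ltnW mn)); elim: (n - m)%N => [|k IH].
  by rewrite addn0 !big_geq// subr0.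
rewrite addnS !big_nat_recr ?leq_addr//=.
set s := \sum_(_ <= _ < _) _ in IH *; set P := \prod_(_ <= _ < _) _ in IH *.
have /andP[y0 y1] := y01 (m + k)%N.
have P1 : P <= 1.
  by apply: prodr_ile1 => i _; have /andP[? ?] := y01 i; rewrite subr_ge0 gerBl; apply/andP.
have -> : P * (1 - y (m + k)%N) = P - P * y (m + k)%N by ring.
rewrite opprD addrA lerB// ler_piMl//.
Qed.

Lemma qpoch_factor_norm_le a p k : `|a| < 1 -> `|p| < 1 ->
  0 <= `|a| * `|p| ^+ k < 1.
Proof.
move=> a1 p1; rewrite mulr_ge0 ?exprn_ge0//=.
by apply: le_lt_trans a1; rewrite -[leRHS]mulr1 ler_wpM2l// exprn_ile1// ltW.
Qed.

(** If the [N]-th power of the norm of [p] is below half of 1 minus that norm, the terms from [N] on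
    sum to at most 1/2. By the Weierstrass inequality those factors contribute at least 1/2, and the
    first [N] form a positive constant. *)
Lemma qpoch_lower_bound a p : `|a| < 1 -> `|p| < 1 ->
  exists2 c : K, 0 < c & forall n, c <= \prod_(0 <= k < n) (1 - `|a| * `|p| ^+ k).
Proof.
move=> a1 p1; have y01 k := qpoch_factor_norm_le a p k a1 p1.
pose P n := \prod_(0 <= k < n) (1 - `|a| * `|p| ^+ k).
have P0 n : 0 < P n.
  by apply: prodr_gt0 => k _; rewrite subr_gt0; case/andP: (y01 k).
have e0 : 0 < (1 - `|p|) / 2 by rewrite divr_gt0// subr_gt0.
have pp1 : `| `|p| | < 1 by rewrite normr_id.
have /cvgrPdist_lt/(_ _ e0)[N _ /(_ N (leqnn N))] := cvg_geometric0 _ compl _ pp1.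
rewrite sub0r normrN normrX normr_id => pN.
exists (P N / 2); first by rewrite divr_gt0.
(* All factors are at most 1, so lengthening the product to [N + n] can only decrease it. *)
move=> n; apply: le_trans (_ : P (N + n)%N <= _); last first.
  rewrite /P (@big_cat_nat _ _ _ n)//= ?leq_addl//.
  rewrite ler_piMr//; first exact: ltW (P0 n).
  apply: prodr_ile1 => k _; have /andP[? ?] := y01 k.
  by rewrite subr_ge0 gerBl ltW//; apply/andP.
rewrite /P [leRHS](@big_cat_nat _ _ _ N)//= ?leq_addr// ler_pM2l ?P0//.
apply: le_trans (weierstrass_product (fun k => `|a| * `|p| ^+ k) _ _ _); last first.
  by move=> k; have /andP[-> /ltW ->] := y01 k.
rewrite lerBrDr -lerBrDl (_ : 1 - 2^-1 = 2^-1 :> K); last by field.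
rewrite -[N in \sum_(N <= _ < _) _]add0n big_addn addKn.
apply: le_trans (_ : `|p| ^+ N * \sum_(0 <= i < n) `|p| ^+ i <= _).
  rewrite mulr_sumr ler_sum// => i _.
  by rewrite addnC exprD -[leRHS]mul1r ler_wpM2r ?mulr_ge0 ?exprn_ge0// ltW.
apply: le_trans (_ : (1 - `|p|) / 2 * (1 - `|p|)^-1 <= _).
  apply: ler_pM; [exact: exprn_ge0| |exact: ltW|exact: geometric_sum_le].
  by apply: sumr_ge0 => i _; exact: exprn_ge0.
by rewrite mulrAC mulfV ?mul1r// subr_eq0 gt_eqF.
Qed.

Lemma qpoch_norm_ge a p n : `|a| < 1 -> `|p| < 1 ->
  \prod_(0 <= k < n) (1 - `|a| * `|p| ^+ k) <= `|qpoch K a p n|.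
Proof.
move=> a1 p1; rewrite normr_prod; apply: ler_prod => k _.
have /andP[y0 y1] := qpoch_factor_norm_le a p k a1 p1.
rewrite subr_ge0 ltW//= -normrX -normrM.
by rewrite -{1}(normr1 K) lerB_dist.
Qed.

(** Factorwise [1 + y <= (1 - y)^-1], because [(1 + y) * (1 - y) <= 1]. *)
Lemma qpoch_norm_le a p n : `|a| < 1 -> `|p| < 1 ->
  `|qpoch K a p n| <= (\prod_(0 <= k < n) (1 - `|a| * `|p| ^+ k))^-1.
Proof.
move=> a1 p1; rewrite normr_prod -prodfV; apply: ler_prod => k _.
have /andP[y0 y1] := qpoch_factor_norm_le a p k a1 p1.
rewrite normr_ge0 /=; apply: le_trans (ler_normB _ _) _.
rewrite normr1 normrM normrX -[leRHS]mul1r ler_pdivlMr ?subr_gt0//.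
by rewrite mulrC -subr_sqr expr1n gerBl exprn_ge0.
Qed.

(** Uniform bounds away from 0 and infinity: they give convergence, a nonzero limit and the
    domination for Tannery's theorem. *)
Lemma qpoch_bounds a p : `|a| < 1 -> `|p| < 1 ->
  exists2 c : K, 0 < c & forall n, c <= `|qpoch K a p n| <= c^-1.
Proof.
move=> a1 p1; have [c c0 hc] := qpoch_lower_bound a p a1 p1; exists c => // n.
rewrite (le_trans (hc n) (qpoch_norm_ge _ _ _ a1 p1)) /=.
rewrite (le_trans (qpoch_norm_le _ _ _ a1 p1))// lef_pV2 ?posrE//.
exact: lt_le_trans (hc n).
Qed.

Lemma qpoch_neq0 a p n : `|a| < 1 -> `|p| < 1 -> qpoch K a p n != 0.
Proof.
move=> a1 p1; have [c c0 /(_ n)/andP[h _]] := qpoch_bounds a p a1 p1.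
by rewrite -normr_gt0; exact: lt_le_trans h.
Qed.

(** Consecutive products differ, up to sign, by [qpoch K a p k * (a * p ^+ k)], so the telescoping
    series is dominated by a geometric one. *)
Lemma qpoch_cvg a p : `|a| < 1 -> `|p| < 1 ->
  (qpoch K a p @ \oo --> qpochoo K a p)%classic.
Proof.
move=> a1 p1; have [c c0 hc] := qpoch_bounds a p a1 p1.
suff /cvg_ex[/= l hl] : cvgn (series (telescope (qpoch K a p))).
  apply/cvg_ex; exists (l + qpoch K a p 0%N).
  apply: (eq_cvgn _ _ _ _ (cvgD hl (cvg_cst (qpoch K a p 0%N)))) => n.
  by rewrite [LHS]addrC -eq_sum_telescope.
apply: compl; exists (c^-1 * (1 - `|p|)^-1) => n.
apply: le_trans (_ : c^-1 * \sum_(0 <= k < n) `|p| ^+ k <= _); last first.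
  by rewrite ler_wpM2l ?geometric_sum_le// invr_ge0 ltW.
rewrite mulr_sumr; apply: ler_sum => k _; rewrite /telescope /=.
have -> : qpoch K a p k.+1 - qpoch K a p k = qpoch K a p k * - (a * p ^+ k).
  by rewrite /qpoch big_nat_recr//=; ring.
rewrite normrM normrN normrM normrX ler_pM ?mulr_ge0 ?exprn_ge0//.
  by case/andP: (hc k).
by rewrite -[leRHS]mul1r ler_wpM2r ?exprn_ge0// ltW.
Qed.

Lemma qpochoo_neq0 a p : `|a| < 1 -> `|p| < 1 -> qpochoo K a p != 0.
Proof.
move=> a1 p1; have [c c0 hc] := qpoch_bounds a p a1 p1; apply/eqP => h0.
have := qpoch_cvg a p a1 p1; rewrite h0 => /cvgrPdist_lt/(_ _ c0)[n _].
move=> /(_ n (leqnn n)); rewrite sub0r normrN.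
by case/andP: (hc n) => h _ /(le_lt_trans h); rewrite ltxx.
Qed.

Lemma cvg_subsequence (v : nat -> K) (l : K) (f : nat -> nat) :
  (forall m, exists N, forall n, (N <= n)%N -> (m <= f n)%N) ->
  (v @ \oo --> l)%classic -> ((v \o f) @ \oo --> l)%classic.
Proof.
move=> hf /cvgrPdist_lt vl; apply/cvgrPdist_lt => e /vl[m _ hm].
by have [N hN] := hf m; exists N => // n /hN; exact: hm.
Qed.

Lemma qpoch_multisection a p m n :
  qpoch K a p (m * n) = \prod_(0 <= i < m) qpoch K (a * p ^+ i) (p ^+ m) n.
Proof.
elim: n => [|n IH].
  by rewrite muln0 /qpoch big_geq// big1// => i _; rewrite big_geq.
rewrite mulnS addnC /qpoch (@big_cat_nat _ _ _ (m * n))//= ?leq_addr//.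
rewrite -/(qpoch K a p (m * n)) IH -[(m * n)%N in X in _ * X]add0n big_addn.
rewrite addKn -big_split /=; apply: eq_bigr => i _.
by rewrite /qpoch big_nat_recr//= -!mulrA -exprM -exprD addnC.
Qed.

Lemma qpochoo_multisection a p m : `|a| < 1 -> `|p| < 1 -> (0 < m)%N ->
  qpochoo K a p = \prod_(0 <= i < m) qpochoo K (a * p ^+ i) (p ^+ m).
Proof.
move=> a1 p1 m0; have pm1 : `|p ^+ m| < 1 by rewrite normrX exprn_ilt1 -?lt0n.
have ai i : `|a * p ^+ i| < 1.
  by rewrite normrM normrX; case/andP: (qpoch_factor_norm_le a p i a1 p1).
have h1 := qpoch_cvg a p a1 p1.
have : ((qpoch K a p \o (fun n => m * n)%N) @ \oo --> qpochoo K a p)%classic.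
  apply: cvg_subsequence h1 => k; exists k => n kn.
  by rewrite (leq_trans kn)// leq_pmull.
move/(eq_cvgn _ _ _ (qpoch_multisection a p m)).
move/(cvg_unique (@norm_hausdorff _ _)); apply.
suff h k : ((fun n => \prod_(0 <= i < k) qpoch K (a * p ^+ i) (p ^+ m) n) @ \oo
    --> \prod_(0 <= i < k) qpochoo K (a * p ^+ i) (p ^+ m))%classic by exact: h.
elim: k => [|k IH].
  rewrite big_geq//; apply: (eq_cvgn (fun=> 1)) => [n|].
    by rewrite big_geq.
  exact: cvg_cst.
rewrite big_nat_recr//=.
apply: (eq_cvgn _ _ _ _ (cvgM IH (qpoch_cvg _ _ (ai k) pm1))) => n.
by rewrite big_nat_recr.
Qed.

Lemma qpochoo_sqr a p : `|a| < 1 -> `|p| < 1 ->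
  qpochoo K a p * qpochoo K (- a) p = qpochoo K (a ^+ 2) (p ^+ 2).
Proof.
move=> a1 p1; have na1 : `|- a| < 1 by rewrite normrN.
have h2 : (qpoch K (a ^+ 2) (p ^+ 2) @ \oo --> qpochoo K (a ^+ 2) (p ^+ 2))%classic.
  by apply: qpoch_cvg; rewrite normrX exprn_ilt1.
suff h : (qpoch K (a ^+ 2) (p ^+ 2) @ \oo -->
    qpochoo K a p * qpochoo K (- a) p)%classic.
  exact: (cvg_unique (@norm_hausdorff _ _) h h2).
apply: (eq_cvgn _ _ _ _ (cvgM (qpoch_cvg _ _ a1 p1) (qpoch_cvg _ _ na1 p1))) => n /=.
rewrite /qpoch -big_split /=; apply: eq_bigr => k _.
by rewrite -exprM mulnC exprM; ring.
Qed.

End QPoch.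

(** * Jacobi's triple product *)

(** The Gaussian binomial coefficient when [i <= n]; for larger [i] the subtraction truncates to 0
    and the value has no combinatorial meaning. *)
Definition qbin (K : numFieldType) (p : K) (n i : nat) : K :=
  qpoch K p p n / (qpoch K p p i * qpoch K p p (n - i)).

Lemma bin2_doublez n : 'C(n, 2)%:Z * 2 = n%:Z * (n%:Z - 1).
Proof. by case: n => // n; have := bin2_double n; lia. Qed.

Section TripleProduct.
Variable K : numFieldType.
Hypothesis compl : abs_complete K.
Implicit Types a b p z : K.

(** Convergence of the coefficients settles the finitely many terms in [s0]; [M] times the small
    absolute tail of [u] controls the others uniformly in [n]. *)
Lemma has_sum_tannery (T : eqType) (u : T -> K) (l M d : K) (s : nat -> seq T)
    (c : nat -> T -> K) :
  has_sum K T u l -> (forall n, uniq (s n)) ->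
  (forall i, exists N, forall n, (N <= n)%N -> i \in s n) ->
  0 <= M -> (forall n i, `|c n i| <= M) ->
  (forall i, ((fun n => c n i) @ \oo --> d)%classic) ->
  ((fun n => \sum_(i <- s n) c n i * u i) @ \oo --> d * l)%classic.
Proof.
move=> ul us sT M0 cM cd; apply/cvgrPdist_lt => e e0.
have e20 : 0 < e / 2 by rewrite divr_gt0.
pose B := `|d| + M + 1; have B0 : 0 < B by rewrite ltr_wpDl// addr_ge0.
have [s0 [us0 s0l tail]] := ul _ (divr_gt0 e20 B0).
have cvgs t : ((fun n => \sum_(i <- t) c n i * u i) @ \oo -->
    d * \sum_(i <- t) u i)%classic.
  elim: t => [|i t IH].
    rewrite big_nil mulr0; apply: (eq_cvgn _ (fun=> 0)) => [n|].
      by rewrite big_nil.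
    exact: cvg_cst.
  rewrite big_cons mulrDr.
  apply: (eq_cvgn _ _ _ _ _ (cvgD (cvgM (cd i) (cvg_cst (u i))) IH)) => n.
  by rewrite big_cons.
have [N hN] : exists N, forall n, (N <= n)%N -> {subset s0 <= s n}.
  elim: (s0) => [|i t [N hN]]; first by exists 0%N.
  have [N' hN'] := sT i; exists (maxn N N') => n; rewrite geq_max => /andP[n1 n2] j.
  by rewrite inE => /predU1P[->|]; [exact: hN'|exact: hN].
have /cvgrPdist_lt/(_ _ e20)[N' _ hN'] := cvgs s0.
exists (maxn N N') => // n; rewrite /= geq_max => /andP[n1 n2].
rewrite (big_uniq_subset _ _ _ s0 (s n))//; last exact: hN.
set r := [seq i <- s n | _]; set t := \sum_(i <- s0) _.
(* Three errors: the coefficients on [s0], the replacement of [l] by the sum over [s0], and the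
   terms off [s0]. The last two share [e / 2] through [B]. *)
have -> : d * l - (t + \sum_(i <- r) c n i * u i) =
    (d * (\sum_(i <- s0) u i) - t) +
    (- (d * (\sum_(i <- s0) u i - l)) - \sum_(i <- r) c n i * u i) by ring.
rewrite [ltRHS](splitr e) (le_lt_trans (ler_normD _ _))// ltr_leD//; first exact: hN'.
apply: le_trans (ler_normB _ _) _; rewrite normrN normrM.
have -> : e / 2 = `|d| * (e / 2 / B) + (M + 1) * (e / 2 / B).
  by rewrite -mulrDl addrA -/B [B * _]mulrC divfK// gt_eqF.
apply: lerD; first by rewrite ler_wpM2l// ltW.
apply: le_trans (ler_norm_sum _ _ _) _.
apply: le_trans (_ : M * \sum_(i <- r) `|u i| <= _).
  by rewrite mulr_sumr; apply: ler_sum => i _; rewrite normrM ler_wpM2r.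
have hr : \sum_(i <- r) `|u i| < e / 2 / B.
  apply: tail; first exact: filter_uniq.
  by move=> i; rewrite mem_filter => /andP[].
by apply: ler_pM; rewrite ?sumr_ge0 ?lerDl// ltW.
Qed.

Lemma qpochS a p n : qpoch K a p n.+1 = qpoch K a p n * (1 - a * p ^+ n).
Proof. by rewrite /qpoch big_nat_recr. Qed.

Lemma qbin0 p n : `|p| < 1 -> qbin K p n 0 = 1.
Proof.
by move=> p1; rewrite /qbin subn0 {2}/qpoch big_geq// mul1r mulfV// qpoch_neq0.
Qed.

Lemma qbinn p n : `|p| < 1 -> qbin K p n n = 1.
Proof.
by move=> p1; rewrite /qbin subnn {3}/qpoch big_geq// mulr1 mulfV// qpoch_neq0.
Qed.

(** The q-Pascal rule. With [n = i + m + 1], clearing denominators leaves [1 - p^(n+1) = (1 -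
    p^(m+1)) + p^(m+1) (1 - p^(i+1))]. *)
Lemma qbinS p n i : `|p| < 1 -> (i < n)%N ->
  qbin K p n.+1 i.+1 = qbin K p n i.+1 + p ^+ (n - i) * qbin K p n i.
Proof.
move=> p1 lin; rewrite /qbin subSS.
have -> : (n - i)%N = (n - i.+1).+1 by lia.
set m := (n - i.+1)%N.
have pn : p ^+ n = p ^+ i * (p * p ^+ m).
  by rewrite -exprS -exprD; congr (_ ^+ _); rewrite /m; lia.
have := qpoch_neq0 _ compl p p i.+1 p1 p1.
have := qpoch_neq0 _ compl p p m.+1 p1 p1.
rewrite !qpochS !mulf_eq0 !negb_or pn exprS => /andP[hm hm1] /andP[hi hi1].
by field; rewrite hm hi hm1 hi1.
Qed.

Lemma qbinomial_theorem p z n : `|p| < 1 ->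
  \prod_(0 <= k < n) (1 + z * p ^+ k) =
  \sum_(0 <= i < n.+1) qbin K p n i * p ^+ 'C(i, 2) * z ^+ i.
Proof.
move=> p1; elim: n => [|n IH].
  by rewrite big_geq// big_nat1 qbin0// !expr0 !mulr1.
rewrite big_nat_recr//= {}IH mulrDr mulr1.
(* The extreme terms are split off because the q-Pascal rule covers only [i < n]. *)
rewrite [RHS]big_nat_recl// [X in _ = _ + X]big_nat_recr//=.
rewrite [X in X + _ = _]big_nat_recl//= mulr_suml [X in _ + X = _]big_nat_recr//=.
rewrite !qbin0// !qbinn// -!addrA; congr (_ + _).
rewrite addrA -big_split /=; congr (_ + _).
  rewrite [LHS]big_nat [RHS]big_nat; apply: eq_bigr => i /andP[_ lin].
  rewrite qbinS// binS bin1 exprD.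
  have -> : p ^+ n = p ^+ (n - i) * p ^+ i by rewrite -exprD subnK// ltnW.
  by rewrite !exprS; ring.
by rewrite binS bin1 exprD !exprS; ring.
Qed.

Lemma theta_termE a b (t : int) : a != 0 -> b != 0 ->
  theta_term K a b t = (a * b) ^ ((t * (t - 1)) %/ 2)%Z * a ^ t.
Proof.
move=> a0 b0; rewrite /theta_term expfzMl mulrAC -expfzDr//.
by congr (a ^ _ * _); tri_solve.
Qed.

Lemma prod_geometric (x p y : K) n :
  \prod_(0 <= k < n) (x * p ^+ k / y) = x ^+ n * p ^+ 'C(n, 2) / y ^+ n.
Proof.
elim: n => [|n IH]; first by rewrite big_geq// !expr0 mul1r invr1 mulr1.
by rewrite big_nat_recr//= IH binS bin1 exprD !exprS invfM; ring.
Qed.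

(* The q-binomial theorem of even length [2n], recentred at its middle term. *)
Lemma finite_triple_product a b n : a != 0 -> b != 0 -> `|a * b| < 1 ->
  qpoch K (- a) (a * b) n * qpoch K (- b) (a * b) n =
  \sum_(0 <= i < n.*2.+1) qbin K (a * b) n.*2 i * theta_term K a b (i%:Z - n%:Z).
Proof.
move=> a0 b0 p1.
have p0 : a * b != 0 by rewrite mulf_neq0.
have pX m : (a * b) ^+ m != 0 by rewrite expf_neq0.
(* With [p = a * b], [1 + a p^(k-n) = a p^(k-n) (1 + b p^(n-k-1))]; [Z] collects the factors pulled
   out for [k < n]. *)
pose Z := \prod_(0 <= k < n) (a * (a * b) ^+ k / (a * b) ^+ n).
have Z0 : Z != 0.
  by rewrite /Z prod_geometric !mulf_neq0 ?invr_eq0 ?expf_neq0.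
apply: (mulfI Z0); rewrite mulr_sumr.
transitivity (\prod_(0 <= k < n.*2) (1 + a / (a * b) ^+ n * (a * b) ^+ k)).
  rewrite -addnn [RHS](@big_cat_nat _ _ _ n)//= ?leq_addr//.
  rewrite -[X in _ = _ * \prod_(X <= _ < _) _]add0n big_addn addnK.
  rewrite mulrCA mulrC; congr (_ * _).
    rewrite /qpoch [X in Z * X]big_nat_rev /Z -big_split /= add0n.
    rewrite [LHS]big_nat [RHS]big_nat; apply: eq_bigr => k /andP[_ kn].
    have -> : (a * b) ^+ n = (a * b) ^+ k * ((a * b) * (a * b) ^+ (n - k.+1)).
      by rewrite -exprS -exprD; congr (_ ^+ _); lia.
    by field; rewrite ?pX ?a0 ?b0.
  apply: eq_bigr => k _; rewrite exprD; field.
  by rewrite pX.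
rewrite qbinomial_theorem//; apply: eq_bigr => i _.
rewrite -mulrA [RHS]mulrCA; congr (_ * _).
rewrite /Z prod_geometric theta_termE// expr_div_n -!exprM.
have -> : a ^+ i = a ^+ n * a ^ (i%:Z - n%:Z).
  by rewrite !exprnP -expfzDr//; congr (a ^ _); ring.
set T := (_ %/ 2)%Z.
(* Completing the square: [C(i,2) + n^2 = C(n,2) + T + n i] for [T = (i - n) (i - n - 1) / 2]. *)
have h : (a * b) ^+ 'C(i, 2) * (a * b) ^+ (n * n) =
    (a * b) ^+ 'C(n, 2) * (a * b) ^ T * (a * b) ^+ (n * i).
  rewrite !exprnP -!expfzDr//; congr (_ ^ _); rewrite /T.
  by have := bin2_doublez i; have := bin2_doublez n; tri_atoms; lia.
have {}h : (a * b) ^+ 'C(i, 2) / (a * b) ^+ (n * i) =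
    (a * b) ^+ 'C(n, 2) * (a * b) ^ T / (a * b) ^+ (n * n).
  by apply/eqP; rewrite eqr_div// h.
transitivity ((a * b) ^+ 'C(i, 2) / (a * b) ^+ (n * i) *
  (a ^+ n * a ^ (i%:Z - n%:Z))); first by ring.
by rewrite h; ring.
Qed.

(** In the finite identity the coefficient of each fixed term tends to [E / (E * E)], where [E] is
    the third product; multiplying the limit by [E] gives the claim. *)
Lemma jacobi_triple_product a b : a != 0 -> b != 0 -> `|a| < 1 -> `|b| < 1 ->
  ftheta a b =
  qpochoo K (- a) (a * b) * qpochoo K (- b) (a * b) * qpochoo K (a * b) (a * b).
Proof.
move=> a0 b0 a1 b1; set p := a * b.
have p1 : `|p| < 1 by rewrite normrM mulr_ilt1.
have E0 := qpochoo_neq0 _ compl p p p1 p1.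
have cE := qpoch_cvg _ compl p p p1 p1.
have na1 : `|- a| < 1 by rewrite normrN.
have nb1 : `|- b| < 1 by rewrite normrN.
(* On the range summed [n + j] is nonnegative and [absz] is exact; for other [j] only boundedness
   and the limit in [n] matter. *)
pose c n (j : int) := qbin K p n.*2 (absz (n%:Z + j)).
pose s n := [seq i%:Z - n%:Z | i <- index_iota 0 n.*2.+1].
have [B B0 hB] := qpoch_bounds _ compl p p p1 p1.
have B1 : 0 <= B^-1 by rewrite invr_ge0 ltW.
pose E := qpochoo K p p.
have cd j : ((fun n => c n j) @ \oo --> E / (E * E))%classic.
  have h1 := cvg_subsequence _ _ _ (fun n => n.*2) _ cE.
  have h2 := cvg_subsequence _ _ _ (fun n => (absz (n%:Z + j))) _ cE.
  have h3 := cvg_subsequence _ _ _ (fun n => n.*2 - absz (n%:Z + j)%R)%N _ cE.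
  apply: (cvgM (h1 _) (cvgV _ (cvgM (h2 _) (h3 _)))).
  - by move=> m; exists m => n; clear; lia.
  - by rewrite mulf_neq0.
  - by move=> m; exists (m + absz j)%N => n; clear; lia.
  - by move=> m; exists (m + absz j)%N => n; clear; lia.
have hs : ((fun n => \sum_(i <- s n) c n i * theta_term K a b i) @ \oo -->
    E / (E * E) * ftheta a b)%classic.
  apply: (has_sum_tannery _ _ _ (B^-1 * (B^-1 * B^-1))) => //.
  - by apply: ftheta_has_sum => //; exact: ltW.
  - move=> n; rewrite map_inj_uniq ?iota_uniq// => x y; clear; lia.
  - move=> j; exists (absz j) => n nj; apply/mapP; exists (absz (n%:Z + j)).
      by rewrite mem_index_iota; move: nj; clear; lia.
    by move: nj; clear; lia.
  - by rewrite !mulr_ge0.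
  - move=> n i; rewrite /c /qbin normrM normfV normrM invfM.
    by rewrite !ler_pM ?mulr_ge0 ?invr_ge0//;
      [case/andP: (hB n.*2)|rewrite lef_pV2 ?posrE ?normr_gt0 ?qpoch_neq0//;
         case/andP: (hB (absz (n%:Z + i)))
      |rewrite lef_pV2 ?posrE ?normr_gt0 ?qpoch_neq0//;
         case/andP: (hB (n.*2 - absz (n%:Z + i)%R)%N)].
have hP := cvgM (qpoch_cvg _ compl _ _ na1 p1) (qpoch_cvg _ compl _ _ nb1 p1).
have {}hs : ((qpoch K (- a) p \* qpoch K (- b) p) @ \oo -->
    E / (E * E) * ftheta a b)%classic.
  apply: eq_cvgn hs => n /=; rewrite finite_triple_product// big_map.
  apply: eq_bigr => i _; rewrite /c; congr (qbin _ _ _ _ * _).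
  by clear; lia.
rewrite (cvg_unique (@norm_hausdorff _ _) (hP _) hs) -/E.
by field.
Qed.

End TripleProduct.

(** * Theta functions of order seven *)

Section SeventhOrder.
Variable K : numFieldType.
Hypothesis compl : abs_complete K.
Implicit Types q x y : K.

(** For infinite products, the triple product gives (-q;q^4)(-q^3;q^4)(q^4;q^4). The first two merge
    into (-q;q^2), which times (q;q^2) is (q^2;q^4), and (q^4;q^4) completes it to (q^2;q^2). *)
Lemma psi_qpochoo q : q != 0 -> `|q| < 1 ->
  psi q * qpochoo K q (q ^+ 2) = qpochoo K (q ^+ 2) (q ^+ 2).
Proof.
move=> q0 q1; have qX n : `|q ^+ n.+1| < 1 by rewrite normrX exprn_ilt1.
rewrite /psi jacobi_triple_product ?expf_neq0// -exprS.
have := qpochoo_multisection _ compl (- q) (q ^+ 2) 2.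
rewrite normrN => /(_ q1 (qX _) isT).
rewrite !big_nat_recr//= big_geq// mul1r mulr1 -exprM mulNr -exprS => <-.
rewrite (mulrAC _ _ (qpochoo K q _)) [X in X * _]mulrC qpochoo_sqr// -exprM.
rewrite [RHS](qpochoo_multisection _ compl _ _ 2)//.
by rewrite !big_nat_recr//= big_geq// mul1r mulr1 -exprM -expr2 -exprM.
Qed.

Lemma ftheta_neg_qpochoo q i j : q != 0 -> `|q| < 1 ->
  ftheta (- q ^+ i.+1) (- q ^+ j.+1) =
  qpochoo K (q ^+ i.+1) (q ^+ (i.+1 + j.+1)) *
  qpochoo K (q ^+ j.+1) (q ^+ (i.+1 + j.+1)) *
  qpochoo K (q ^+ (i.+1 + j.+1)) (q ^+ (i.+1 + j.+1)).
Proof.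
move=> q0 q1; have qX n : `|q ^+ n.+1| < 1 by rewrite normrX exprn_ilt1.
by rewrite jacobi_triple_product ?oppr_eq0 ?expf_neq0 ?normrN// mulrNN -exprD !opprK.
Qed.

(** In terms of the products [P i] to base [q ^+ 14], both sides have the odd indices except 7 above
    and the even indices below 14 underneath; every [P 14] cancels. *)
Lemma ftheta_quotient q : q != 0 -> `|q| < 1 ->
  ftheta (- q) (- q ^+ 13) * ftheta (- q ^+ 3) (- q ^+ 11) *
    ftheta (- q ^+ 5) (- q ^+ 9) /
  (ftheta (- q ^+ 6) (- q ^+ 8) * ftheta (- q ^+ 4) (- q ^+ 10) *
    ftheta (- q ^+ 2) (- q ^+ 12)) = psi (q ^+ 7) / psi q.
Proof.
move=> q0 q1; have qX n : `|q ^+ n.+1| < 1 by rewrite normrX exprn_ilt1.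
have P0 i j : qpochoo K (q ^+ i.+1) (q ^+ j.+1) != 0 by exact: qpochoo_neq0.
pose P i := qpochoo K (q ^+ i) (q ^+ 14).
have d1 : qpochoo K q (q ^+ 2) = P 1 * P 3 * P 5 * P 7 * P 9 * P 11 * P 13.
  rewrite (qpochoo_multisection _ compl _ _ 7 q1 (qX 1%N) isT).
  by rewrite !big_nat_recr//= big_geq// mul1r -!exprM -!exprS.
have d2 : qpochoo K (q ^+ 2) (q ^+ 2) =
    P 2 * P 4 * P 6 * P 8 * P 10 * P 12 * P 14.
  rewrite (qpochoo_multisection _ compl _ _ 7 (qX 1%N) (qX 1%N) isT).
  by rewrite !big_nat_recr//= big_geq// mul1r -!exprM -!exprD.
have psi1 : psi q = P 2 * P 4 * P 6 * P 8 * P 10 * P 12 * P 14 /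
    (P 1 * P 3 * P 5 * P 7 * P 9 * P 11 * P 13).
  rewrite -d2 -d1 -psi_qpochoo// mulfK//.
  exact: (P0 0%N 1%N).
have psi7 : psi (q ^+ 7) = P 14 / P 7.
  have := psi_qpochoo _ (expf_neq0 7 q0) (qX 6); rewrite -exprM => h.
  by rewrite /P -h mulfK//; exact: (P0 6%N 13%N).
have f i j : (i.+1 + j.+1 = 14)%N ->
    ftheta (- q ^+ i.+1) (- q ^+ j.+1) = P i.+1 * P j.+1 * P 14.
  by move=> ij; rewrite ftheta_neg_qpochoo// ij.
rewrite -[X in ftheta (- X) (- _ ^+ 13)]expr1 !f// psi1 psi7.
have {}P0 i : P i.+1 != 0 by exact: P0.
by field; rewrite !P0.
Qed.

Lemma reciprocal_pm (x A B p f F : K) :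
  p * f = B * A ->
  (F = A ^+ 2 - x ^+ 2 * B ^+ 2 ->
    (x * (B / A))^-1 - x * (B / A) = F / (x * p * f)) /\
  (F = A ^+ 2 + x ^+ 2 * B ^+ 2 ->
    (x * (B / A))^-1 + x * (B / A) = F / (x * p * f)).
Proof.
move=> pf; rewrite -mulrA pf.
(* If [x], [A] or [B] is 0, both sides are 0 because the inverse of 0 is 0. *)
have [->|x0] := eqVneq x 0; first by rewrite !mul0r !invr0 !mulr0 subr0 addr0.
have [->|A0] := eqVneq A 0.
  by rewrite !mulr0 !invr0 !mulr0 !invr0 subr0 addr0.
have [->|B0] := eqVneq B 0.
  by rewrite !mul0r !mulr0 !invr0 !mulr0 subr0 addr0.
by split=> ->; field; rewrite x0 A0 B0.
Qed.

(* [x = q^(1/4)] and [y = q^(1/2)], so that [k = 1, 3, 5] gives [S1], [S2], [S3]. *)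
Lemma seventh_order_relations x y k : (0 < k < 7)%N -> y = x ^+ 2 -> `|y| < 1 ->
  let S := x ^+ k * (ftheta (- y ^+ (7 - k)) (- y ^+ (21 + k)) /
                     ftheta (- y ^+ (7 + k)) (- y ^+ (21 - k))) in
  let D := x ^+ k * psi (y ^+ 14) * ftheta (- y ^+ (7 - k)) (- y ^+ (7 + k)) in
  S^-1 - S = phi (y ^+ 7) * ftheta (- y ^+ k) (- y ^+ (14 - k)) / D /\
  S^-1 + S = phi (- y ^+ 7) * ftheta (y ^+ k) (y ^+ (14 - k)) / D.
Proof.
move=> /andP[k0 k7] yE y1 S D.
have [x0|x0] := eqVneq x 0.
  by rewrite /S /D x0 expr0n gtn_eqF// !mul0r !invr0 !mulr0 subr0 addr0.
have y0 : y != 0 by rewrite yE expf_neq0.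
have yX n : (0 < n)%N -> `|y ^+ n| < 1.
  by move=> n0; rewrite normrX exprn_ilt1// -lt0n.
have nyX n : (0 < n)%N -> `|- y ^+ n| < 1 by rewrite normrN; exact: yX.
have k7' : (0 < 7 - k)%N by rewrite subn_gt0.
have ny0 n : - y ^+ n != 0 by rewrite oppr_eq0 expf_neq0.
have sym : ftheta (- y ^+ (21 + k)) (- y ^+ (7 - k)) =
    ftheta (- y ^+ (7 - k)) (- y ^+ (21 + k)).
  by apply: fthetaC => //; rewrite ?normrM ?mulr_ilt1 ?nyX ?(ltW (nyX _ _)) ?ltn_addl.
have xk : (x ^+ k) ^+ 2 = y ^+ k by rewrite yE -!exprM mulnC.
have pf : psi (y ^+ 14) * ftheta (- y ^+ (7 - k)) (- y ^+ (7 + k)) =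
    ftheta (- y ^+ (7 - k)) (- y ^+ (21 + k)) *
    ftheta (- y ^+ (7 + k)) (- y ^+ (21 - k)).
  have := psi_mul_ftheta _ compl (- y ^+ (7 - k)) (- y ^+ (7 + k)).
  move=> /(_ (ny0 _) (ny0 _) (nyX _ k7') (nyX (7 + k)%N isT)).
  rewrite mulrNN !sqrrN !(mulNr, mulrN) -!exprM -!exprD.
  have -> : (7 - k + (7 + k) = 14)%N by lia.
  have -> : (7 - k + (7 + k) * 2 = 21 + k)%N by lia.
  by have -> : ((7 - k) * 2 + (7 + k) = 21 - k)%N by lia.
have [hm _] := reciprocal_pm (x ^+ k) _ _ _ _
  (phi (y ^+ 7) * ftheta (- y ^+ k) (- y ^+ (14 - k))) pf.
have [_ hp] := reciprocal_pm (x ^+ k) _ _ _ _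
  (phi (- y ^+ 7) * ftheta (y ^+ k) (y ^+ (14 - k))) pf.
have e1 : (k + (7 - k) = 7)%N by lia.
have e2 : (k + (7 - k) * 2 = 14 - k)%N by lia.
have e3 : (k * 2 + (7 - k) = 7 + k)%N by lia.
have e4 : (k * 2 + (7 - k) * 3 = 21 - k)%N by lia.
have e5 : (k * 4 + (7 - k) * 3 = 21 + k)%N by lia.
have o3 (z : K) : (- z) ^+ 3 = - z ^+ 3 by ring.
have o4 (z : K) : (- z) ^+ 4 = z ^+ 4 by ring.
split.
- apply: hm; rewrite xk /phi.
  (* Here [c * e = y ^+ 7], and the factor [c = - y ^+ k] supplies the minus sign. *)
  have := phi_mul_ftheta _ compl (- y ^+ k) (- y ^+ (7 - k)).
  move=> /(_ (ny0 _) (ny0 _) (nyX _ k0) (nyX _ k7')).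
  rewrite mulrNN !sqrrN !o3 !o4 !(mulNr, mulrN) -!exprM -!exprD.
  by rewrite e1 e2 e3 e4 e5 sym.
- apply: hp; rewrite xk /phi.
  (* Changing the sign of [c] alone turns [c * e] into [- y ^+ 7] and leaves both squared theta
     functions unchanged. *)
  have := phi_mul_ftheta _ compl (y ^+ k) (- y ^+ (7 - k)).
  move=> /(_ (expf_neq0 _ y0) (ny0 _) (yX _ k0) (nyX _ k7')).
  rewrite !sqrrN !o3 !(mulNr, mulrN) -!exprM -!exprD.
  by rewrite e1 e2 e3 e4 e5 sym.
Qed.

(** The powers 1, 3, 5 of [y] add up to 9, the source of q^(9/2). *)
Lemma prod3_quotient (h y p N1 N3 N5 D1 D3 D5 r s : K) :
  N1 * N3 * N5 / (D1 * D3 * D5) = r / s ->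
  h * N1 / (y * p * D1) * (h * N3 / (y ^+ 3 * p * D3)) *
    (h * N5 / (y ^+ 5 * p * D5)) = h ^+ 3 * r / (y ^+ 9 * p ^+ 3 * s).
Proof.
move=> quot; transitivity (h ^+ 3 / (y ^+ 9 * p ^+ 3) *
  (N1 * N3 * N5 / (D1 * D3 * D5))).
  by rewrite !invfM; ring.
by rewrite quot !invfM; ring.
Qed.

Lemma ftheta_quotientN q : q != 0 -> `|q| < 1 ->
  ftheta q (q ^+ 13) * ftheta (q ^+ 3) (q ^+ 11) * ftheta (q ^+ 5) (q ^+ 9) /
  (ftheta (- q ^+ 6) (- q ^+ 8) * ftheta (- q ^+ 4) (- q ^+ 10) *
    ftheta (- q ^+ 2) (- q ^+ 12)) = psi (- q ^+ 7) / psi (- q).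
Proof.
move=> q0 q1.
have sgn n : (- q) ^+ n = if odd n then - q ^+ n else q ^+ n.
  by rewrite exprNn -signr_odd; case: odd; rewrite ?mulN1r ?mul1r.
have := ftheta_quotient (- q); rewrite oppr_eq0 normrN => /(_ q0 q1).
by rewrite !sgn /= !opprK.
Qed.

End SeventhOrder.

(** * The eight identities over the complex numbers *)

Local Open Scope complex_scope.

Theorem theorem2p1 (R : realType) (q q12 q14 : R[i])
    (hq : `|q| < 1) (hq12 : q12 ^+ 2 = q) (hq14 : q14 ^+ 2 = q12) :
  (* (i) *)
  ((S1 q14 q)^-1 - S1 q14 q =
    (phi (q12 ^+ 7) * ftheta (- q12) (- q12 ^+ 13)) /
      (q14 * psi (q ^+ 7) * ftheta (- q ^+ 3) (- q ^+ 4))) /\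
  (* (ii) *)
  ((S1 q14 q)^-1 + S1 q14 q =
    (phi (- q12 ^+ 7) * ftheta q12 (q12 ^+ 13)) /
      (q14 * psi (q ^+ 7) * ftheta (- q ^+ 3) (- q ^+ 4))) /\
  (* (iii) *)
  ((S2 q14 q)^-1 - S2 q14 q =
    (phi (q12 ^+ 7) * ftheta (- q12 ^+ 3) (- q12 ^+ 11)) /
      (q14 ^+ 3 * psi (q ^+ 7) * ftheta (- q ^+ 2) (- q ^+ 5))) /\
  (* (iv) *)
  ((S2 q14 q)^-1 + S2 q14 q =
    (phi (- q12 ^+ 7) * ftheta (q12 ^+ 3) (q12 ^+ 11)) /
      (q14 ^+ 3 * psi (q ^+ 7) * ftheta (- q ^+ 2) (- q ^+ 5))) /\
  (* (v) *)
  ((S3 q14 q)^-1 - S3 q14 q =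
    (phi (q12 ^+ 7) * ftheta (- q12 ^+ 5) (- q12 ^+ 9)) /
      (q14 ^+ 5 * psi (q ^+ 7) * ftheta (- q) (- q ^+ 6))) /\
  (* (vi) *)
  ((S3 q14 q)^-1 + S3 q14 q =
    (phi (- q12 ^+ 7) * ftheta (q12 ^+ 5) (q12 ^+ 9)) /
      (q14 ^+ 5 * psi (q ^+ 7) * ftheta (- q) (- q ^+ 6))) /\
  (* (vii); the chosen fourth root of q^2 is q^(1/2) *)
  (((S1 q12 (q ^+ 2))^-1 - S1 q12 (q ^+ 2)) *
   ((S2 q12 (q ^+ 2))^-1 - S2 q12 (q ^+ 2)) *
   ((S3 q12 (q ^+ 2))^-1 - S3 q12 (q ^+ 2)) =
    (phi (q ^+ 7) ^+ 3 * psi (q ^+ 7)) /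
      (q12 ^+ 9 * psi (q ^+ 14) ^+ 3 * psi q)) /\
  (* (viii) *)
  (((S1 q12 (q ^+ 2))^-1 + S1 q12 (q ^+ 2)) *
   ((S2 q12 (q ^+ 2))^-1 + S2 q12 (q ^+ 2)) *
   ((S3 q12 (q ^+ 2))^-1 + S3 q12 (q ^+ 2)) =
    (phi (- q ^+ 7) ^+ 3 * psi (- q ^+ 7)) /
      (q12 ^+ 9 * psi (q ^+ 14) ^+ 3 * psi (- q))).
Proof.
have compl := complex_abs_complete R.
have y1 : `|q12| < 1.
  by rewrite -(expr_lt1 (n := 2))// -normrX hq12.
(* With [y = q12] the general relations give (i)-(vi); with [y = q] they give the factors at
   [q ^+ 2] for (vii) and (viii). *)
have rel k := seventh_order_relations _ compl q14 q12 k.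
have rel2 k := seventh_order_relations _ compl q12 q k.
have [m1 p1] := rel 1%N isT (esym hq14) y1.
have [m3 p3] := rel 3%N isT (esym hq14) y1.
have [m5 p5] := rel 5%N isT (esym hq14) y1.
split; first by rewrite /S1 -hq12 -!exprM; exact: m1.
split; first by rewrite /S1 -hq12 -!exprM; exact: p1.
split; first by rewrite /S2 -hq12 -!exprM; exact: m3.
split; first by rewrite /S2 -hq12 -!exprM; exact: p3.
split; first by rewrite /S3 -hq12 -!exprM; exact: m5.
split; first by rewrite /S3 -hq12 -!exprM; exact: p5.
have [n1 r1] := rel2 1%N isT (esym hq12) hq.
have [n3 r3] := rel2 3%N isT (esym hq12) hq.
have [n5 r5] := rel2 5%N isT (esym hq12) hq.
(* The quotient evaluations assume [q] nonzero; at [q = 0] both sides are 0, as [S1] and [q12 ^+ 9]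
   vanish. *)
have [q0|q0] := eqVneq q 0.
  have /eqP : q12 ^+ 2 = 0 by rewrite hq12.
  rewrite expf_eq0 => /eqP z0.
  have S10 : S1 q12 (q ^+ 2) = 0 by rewrite /S1 z0 mul0r.
  have z9 : q12 ^+ 9 = 0 by rewrite z0 expr0n.
  by split; rewrite S10 z9 invr0 ?subr0 ?addr0 2!mul0r [RHS]mulrC 2!mul0r invr0 mul0r.
split.
- rewrite -(prod3_quotient _ _ _ _ _ _ _ _ _ _ _ _ (ftheta_quotient _ compl q q0 hq)).
  rewrite /S1 /S2 /S3 -!exprM; congr (_ * _ * _); [exact: n1|exact: n3|exact: n5].
- rewrite -(prod3_quotient _ _ _ _ _ _ _ _ _ _ _ _ (ftheta_quotientN _ compl q q0 hq)).
  rewrite /S1 /S2 /S3 -!exprM; congr (_ * _ * _); [exact: r1|exact: r3|exact: r5].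
Qed.
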